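(* Let $(A,+)$ be an elementary abelian $2$-group and $X$ a non-empty set. If $\sigma\colon A\to\operatorname{Sym}(X)$ and $\rho\colon A\to\operatorname{Sym}(X)$ are maps, then the solutions $\operatorname{Ext}_X^\sigma(A,t_A)$ and $\operatorname{Ext}_X^\rho(A,t_A)$ of the PE are isomorphic.
   Context: A (set-theoretic) solution of the Pentagon Equation (PE) is a pair $(S,s)$ where $S$ is a non-empty set and $s\colon S\times S\to S\times S$ satisfies $s_{23}s_{13}s_{12}=s_{12}s_{23}$ on $S^3$, where $s_{ij}$ acts as $s$ on the $i$-th and $j$-th components and as the identity on the remaining one. Two solutions $(S,s),(S',s')$ are isomorphic if there is a bijection $f\colon S\to S'$ with $(f\times f)s=s'(f\times f)$. An elementary abelian $2$-group is an abelian group $(A,+)$ with $x+x=0$ for all $x$ (the trivial group is allowed); $(A,t_A)$ is the solution $t_A(a,b)=(a,a+b)$. For a non-empty set $X$ and a map $\sigma\colon A\to\operatorname{Sym}(X)$, $a\mapsto\sigma_a$ (any map, not necessarily a group morphism), $\operatorname{Ext}_X^\sigma(A,t_A)$ is the involutive solution on $X\times A$ given by $((x,a),(y,b))\mapsto((x,a),(\sigma_{a+b}\sigma_b^{-1}(y),a+b))$. $\operatorname{Sym}(X)$ is the group of permutations of $X$. *)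

(* Defs.v *)
From mathcomp Require Import all_boot all_algebra.
From mathcomp Require Import classical_sets functions.

Set Implicit Arguments.
Unset Strict Implicit.
Unset Printing Implicit Defensive.

Import GRing.Theory.
Local Open Scope ring_scope.

Section LegNumbering.
Variables (S : Type) (s : S * S -> S * S).

Definition leg12 (p : S * S * S) : S * S * S :=
  let: (x, y, z) := p in let: (x', y') := s (x, y) in (x', y', z).

Definition leg13 (p : S * S * S) : S * S * S :=
  let: (x, y, z) := p in let: (x', z') := s (x, z) in (x', y, z').

Definition leg23 (p : S * S * S) : S * S * S :=
  let: (x, y, z) := p in let: (y', z') := s (y, z) in (x, y', z').

Definition pentagon_equation : Prop :=
  leg23 \o leg13 \o leg12 =1 leg12 \o leg23.

End LegNumbering.

Record pe_solution : Type := PESolution {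
  pe_carrier :> Type;
  pe_map : pe_carrier * pe_carrier -> pe_carrier * pe_carrier;
  pe_nonempty : inhabited pe_carrier;
  pe_pentagon : pentagon_equation pe_map
}.

Definition map_square (S T : Type) (f : S -> T) (p : S * S) : T * T :=
  (f p.1, f p.2).

Definition pe_isomorphic (S T : pe_solution) : Prop :=
  exists f : S -> T,
    bijective f /\
    map_square f \o @pe_map S =1 @pe_map T \o map_square f.

Definition elementary_abelian_2group (A : zmodType) : Prop :=
  forall x : A, x + x = 0.

(* A split bijection of the whole type carries its two-sided inverse, which   *)
(* its underlying function determines; X is not required to be finite.        *)
Definition Sym (X : Type) : Type := {splitbij [set: X] >-> [set: X]}.

Section Ext.
Variables (A : zmodType) (X : Type) (sigma : A -> Sym X).

Definition ext_map (p : (X * A) * (X * A)) : (X * A) * (X * A) :=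
  let: ((x, a), (y, b)) := p in
  ((x, a), (sigma (a + b) ((sigma b)^-1%FUN y), a + b)).

Hypothesis A2 : elementary_abelian_2group A.

Lemma ext_map_involutive : involutive ext_map.
Proof.
move=> [[x a] [y b]] /=; rewrite addrA A2 add0r.
by rewrite (funK (in_setT _)) (invK (in_setT _)).
Qed.

Lemma ext_map_pentagon : pentagon_equation ext_map.
Proof.
move=> [[[x a] [y b]] [z c]] /=.
have -> : a + b + (a + c) = b + c by rewrite addrACA A2 add0r.
by rewrite (funK (in_setT _)).
Qed.

Hypothesis X0 : inhabited X.

Lemma ext_nonempty : inhabited (X * A).
Proof. by case: X0 => x; exists; exact: (x, 0). Qed.

Definition Ext : pe_solution := PESolution ext_nonempty ext_map_pentagon.

End Ext.

(* Main.v *)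
(** The maps [rho_a sigma_a^-1] on the fibres of the projection to [A]
    intertwine the cocycles [sigma_(a+b) sigma_b^-1] and
    [rho_(a+b) rho_b^-1], which are both coboundaries. *)
Require Import Defs.
From mathcomp Require Import all_boot all_algebra.
From mathcomp Require Import classical_sets functions.

(** Undoing [sigma a] on the fibre over [a] straightens [Ext sigma] into the map fixing [(x, a)] and
    sending [(y, b)] to [(y, a + b)], which does not depend on [sigma]. [fibre_change] passes
    through this common form. *)

Lemma sym_funK (X : Type) (g : Sym X) : cancel g (g^-1)%FUN.
Proof. by move=> x; rewrite funK ?in_setT. Qed.

Lemma sym_invK (X : Type) (g : Sym X) : cancel (g^-1)%FUN g.
Proof. by move=> x; rewrite invK ?in_setT. Qed.

Definition fibre_change (A X : Type) (sigma rho : A -> Sym X) (p : X * A) :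
    X * A :=
  (rho p.2 ((sigma p.2)^-1%FUN p.1), p.2).

Lemma fibre_changeK (A X : Type) (sigma rho : A -> Sym X) :
  cancel (fibre_change A X sigma rho) (fibre_change A X rho sigma).
Proof.
by move=> [x a]; rewrite /fibre_change /= sym_funK sym_invK.
Qed.

Theorem proposition5p4 (A : zmodType) (hA : elementary_abelian_2group A)
    (X : Type) (hX : inhabited X) (sigma rho : A -> Sym X) :
  pe_isomorphic (Ext sigma hA hX) (Ext rho hA hX).
Proof.
exists (fibre_change A X sigma rho); split.
  (* Swapping [sigma] and [rho] in [fibre_changeK] gives the other inverse law. *)
  by exists (fibre_change A X rho sigma); exact: fibre_changeK.
move=> [[x a] [y b]].
(* [sigma (a + b)] cancels on the left and [rho b] on the right; both sides leave [rho (a + b)]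
   applied to the preimage of [y] under [sigma b]. *)
by rewrite /map_square /fibre_change /= !sym_funK.
Qed.
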